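(* Let $n \geq 2$ be an integer, let $V = \{0, 1, \dotsc, n\}$, and let $m = \binom{n+1}{2}$. Consider vectors $x \in \mathbb{R}^m$ whose coordinates $x_{ij} = x_{ji}$ are indexed by the unordered pairs $\{i,j\}$ of distinct elements of $V$. The following system of linear inequalities in $x$ is totally dual integral: \begin{align*} & x_{0n} \leq 1, \\ & x_{in} \leq x_{i-1,n} && \forall i \in \{1, \dotsc, n-1\}, \\ & x_{0i} \leq x_{0,i+1} && \forall i \in \{1, \dotsc, n-1\}, \\ & x_{i-1,i+1} \leq x_{i-1,i} + x_{i,i+1} && \forall i \in \{1, \dotsc, n-1\}, \\ & x_{j,k} + x_{j+1,k-1} \leq x_{j+1,k} + x_{j,k-1} && \forall j,k \in \{0, \dotsc, n\} \text{ with } j < k-2. \end{align*}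
   Context: A system of linear inequalities $Ax \leq b$ with $A \in \mathbb{Q}^{k \times m}$, $b \in \mathbb{Q}^k$ is called totally dual integral (TDI) if for every $c \in \mathbb{Z}^m$ such that the linear program $\max\{c^\top x \mid Ax \leq b\}$ is feasible and bounded, its dual linear program $\min\{b^\top y \mid A^\top y = c,\ y \geq 0\}$ has an integral optimal solution. *)

(* Defs.v *)
From HB Require Import structures.
From mathcomp Require Import all_boot all_order all_algebra.
From mathcomp Require Import all_reals.

Set Implicit Arguments.
Unset Strict Implicit.
Unset Printing Implicit Defensive.

Import Order.TTheory GRing.Theory Num.Theory.
Local Open Scope ring_scope.

Definition primal_feasible (R : realType) (k m : nat)
    (A : 'M[R]_(k, m)) (b : 'cV[R]_k) (x : 'cV[R]_m) : Prop :=
  forall i, (A *m x) i 0 <= b i 0.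

Definition primal_bounded (R : realType) (k m : nat)
    (A : 'M[R]_(k, m)) (b : 'cV[R]_k) (c : 'cV[R]_m) : Prop :=
  exists M : R, forall x, primal_feasible A b x -> (c^T *m x) 0 0 <= M.

Definition dual_feasible (R : realType) (k m : nat)
    (A : 'M[R]_(k, m)) (c : 'cV[R]_m) (y : 'cV[R]_k) : Prop :=
  A^T *m y = c /\ forall i, 0 <= y i 0.

Definition dual_optimal (R : realType) (k m : nat)
    (A : 'M[R]_(k, m)) (b : 'cV[R]_k) (c : 'cV[R]_m) (y : 'cV[R]_k) : Prop :=
  dual_feasible A c y /\
  forall y', dual_feasible A c y' -> (b^T *m y) 0 0 <= (b^T *m y') 0 0.

Definition TDI (R : realType) (k m : nat)
    (A : 'M[rat]_(k, m)) (b : 'cV[rat]_k) : Prop :=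
  let AR : 'M[R]_(k, m) := map_mx ratr A in
  let bR : 'cV[R]_k := map_mx ratr b in
  forall c : 'cV[int]_m,
  let cR : 'cV[R]_m := map_mx intr c in
  (exists x, primal_feasible AR bR x) ->
  primal_bounded AR bR cR ->
  exists y : 'cV[int]_k, dual_optimal AR bR cR (map_mx intr y).

(* The pair (a, beta) stands for the inequality a x <= beta. *)
Notation ineq m := ('rV[rat]_m * rat)%type.

Definition lhs_mx (m : nat) (s : seq (ineq m)) : 'M[rat]_(size s, m) :=
  \matrix_(i < size s) (tnth (in_tuple s) i).1.

Definition rhs_col (m : nat) (s : seq (ineq m)) : 'cV[rat]_(size s) :=
  \col_(i < size s) (tnth (in_tuple s) i).2.

Definition pairs (n : nat) : {set {set 'I_n.+1}} := [set e : {set 'I_n.+1} | #|e| == 2%N].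

Lemma card_pairs n : #|pairs n| = 'C(n.+1, 2).
Proof. by rewrite card_draws card_ord. Qed.

(* The linear form x |-> x_ij. Only meaningful for distinct i, j <= n: inord
   sends larger indices to 0. *)
Definition X (n i j : nat) : 'rV[rat]_#|pairs n| :=
  \row_e (enum_val e == [set inord i; inord j])%:R.

Definition form_le (m : nat) (f g : 'rV[rat]_m) : ineq m := (f - g, 0).

Definition path_system (n : nat) : seq (ineq #|pairs n|) :=
  [:: (X n 0 n, 1)]
  ++ [seq form_le (X n i n) (X n i.-1 n) | i <- iota 1 n.-1]
  ++ [seq form_le (X n 0 i) (X n 0 i.+1) | i <- iota 1 n.-1]
  ++ [seq form_le (X n i.-1 i.+1) (X n i.-1 i + X n i i.+1)
       | i <- iota 1 n.-1]
  ++ [seq form_le (X n j k + X n j.+1 k.-1) (X n j.+1 k + X n j k.-1)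
       | j <- iota 0 n.+1, k <- [seq k <- iota 0 n.+1 | (j < k - 2)%N]].

Definition coord (R : realType) (n : nat) (x : 'cV[R]_#|pairs n|) (i j : nat) : R :=
  (map_mx ratr (X n i j) *m x) 0 0.

Lemma coordE (R : realType) n (x : 'cV[R]_#|pairs n|) i j e :
  enum_val e = [set inord i; inord j] -> coord x i j = x e 0.
Proof.
move=> he; rewrite /coord mxE (bigD1 e) //= !mxE he eqxx rmorph1 mul1r.
rewrite big1 ?addr0 // => f fe; rewrite !mxE -he.
by rewrite (inj_eq enum_val_inj) (negPf fe) rmorph0 mul0r.
Qed.

Lemma primal_feasible_path (R : realType) n (x : 'cV[R]_#|pairs n|) :
  primal_feasible (map_mx ratr (lhs_mx (path_system n)))
                  (map_mx ratr (rhs_col (path_system n))) x <->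
  [/\ coord x 0 n <= 1,
      forall i, (1 <= i <= n.-1)%N -> coord x i n <= coord x i.-1 n,
      forall i, (1 <= i <= n.-1)%N -> coord x 0 i <= coord x 0 i.+1,
      forall i, (1 <= i <= n.-1)%N ->
        coord x i.-1 i.+1 <= coord x i.-1 i + coord x i i.+1 &
      forall j k, (j <= n)%N -> (k <= n)%N -> (j < k - 2)%N ->
        coord x j k + coord x j.+1 k.-1 <= coord x j.+1 k + coord x j k.-1].
Proof.
pose ok (a : ineq #|pairs n|) := (map_mx ratr a.1 *m x) 0 0 <= ratr a.2 :> R.
have rowE i :
    ((map_mx ratr (lhs_mx (path_system n)) *m x) i 0
       <= map_mx ratr (rhs_col (path_system n)) i 0)
    = ok (tnth (in_tuple (path_system n)) i).
  by rewrite /ok !mxE; congr (_ <= _); apply: eq_bigr => e _; rewrite !mxE.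
have okE : primal_feasible (map_mx ratr (lhs_mx (path_system n)))
    (map_mx ratr (rhs_col (path_system n))) x <-> all ok (path_system n).
  rewrite /primal_feasible; split=> [h|h i].
    by apply/(@all_tnthP _ _ ok (in_tuple _)) => i; rewrite -rowE.
  by rewrite rowE; move/(@all_tnthP _ _ ok (in_tuple _)): h.
have leE f g : ok (form_le f g) =
    ((map_mx ratr f *m x) 0 0 <= (map_mx ratr g *m x) 0 0).
  by rewrite /ok /= rmorph0 map_mxB mulmxBl !mxE subr_le0.
have addE f g : (map_mx ratr (f + g) *m x) 0 0 =
    (map_mx ratr f *m x) 0 0 + (map_mx ratr g *m x) 0 0 :> R.
  by rewrite map_mxD mulmxDl mxE.
have rangeE i : (i \in iota 1 n.-1) = (1 <= i <= n.-1)%N.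
  by rewrite mem_iota add1n ltnS.
rewrite okE /path_system all_cat all_seq1 3!all_cat 3!all_map.
have -> : ok (X n 0 n, 1) = (coord x 0 n <= 1) by rewrite /ok /= rmorph1.
split.
  case/and5P=> h0 /allP h1 /allP h2 /allP h3 /allP h4; split=> //.
  - by move=> i; rewrite -rangeE => /h1; rewrite /= leE.
  - by move=> i; rewrite -rangeE => /h2; rewrite /= leE.
  - by move=> i; rewrite -rangeE => /h3; rewrite /= leE addE.
  - move=> j k jn kn jk; rewrite /coord -!addE -leE; apply: h4.
    apply/allpairsPdep; exists j, k.
    by rewrite mem_filter jk !mem_iota !ltnS.
case=> h0 h1 h2 h3 h4; apply/and5P; split=> //.
- by apply/allP => i; rewrite rangeE => /h1; rewrite /= leE.
- by apply/allP => i; rewrite rangeE => /h2; rewrite /= leE.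
- by apply/allP => i; rewrite rangeE => /h3; rewrite /= leE addE.
- apply/allP => _ /allpairsPdep[j [k [+ + ->]]].
  rewrite mem_filter !mem_iota !ltnS => /= jn /andP[jk kn].
  by rewrite leE !addE; exact: h4.
Qed.

(* Main.v *)
Require Import Defs.
From HB Require Import structures.
From mathcomp Require Import all_boot all_order all_algebra.
From mathcomp Require Import all_reals.
From mathcomp Require Import zify ring.

(* With the convention x_jj = 0 the last two families of inequalities are the
   single condition that the mixed second differences of x have a sign.
   Telescoping expresses x_ab as a 0/1 combination of the left-hand sides of
   the system; this is an integral left inverse of the constraint matrix, so
   A^T y = c has an integral solution, and reading the formula at a = b = h
   gives n - 1 linear relations between the left-hand sides.  In terms of the
   slacks s >= 0 these relations say that every point h of {1, ..., n-1} is
   covered exactly once by s, each inequality being an interval of points.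
   Hence the dual is min Z_(n-1) - Z_0 under difference constraints
   Z_hi - Z_lo >= -w on the intervals: a longest path problem, with an integral
   optimal potential.  A tight path is a partition into intervals, i.e. the
   slack vector of a primal point that certifies optimality. *)

Set Implicit Arguments.
Unset Strict Implicit.
Unset Printing Implicit Defensive.

Import Order.TTheory GRing.Theory Num.Theory.
Local Open Scope ring_scope.

(** * Longest paths on the vertices 0, ..., N *)

Lemma exists_seq_argmax (d : Order.disp_t) (S : orderType d) (T : eqType)
    (f : T -> S) (s : seq T) :
  s != [::] -> exists2 x, x \in s & {in s, forall y, (f y <= f x)%O}.
Proof.
elim: s => // x [_ _|y s IHs _]; first by
  exists x => [|y]; rewrite mem_seq1 // => /eqP ->.
have [z zs zmax] := IHs isT.
have [le_zx|lt_xz] := leP (f z) (f x).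
  exists x => [|u]; first exact: mem_head.
  by rewrite in_cons => /predU1P[-> //|/zmax/le_trans ->].
exists z => [|u]; first by rewrite in_cons zs orbT.
by rewrite in_cons => /predU1P[->|/zmax //]; exact: ltW.
Qed.

Section LongestPath.

Variables (T : eqType) (L : seq T) (lo hi : T -> nat) (N : nat).
Hypothesis lo_hi : {in L, forall l, lo l < hi l}%N.
Hypothesis hi_onto : forall b, (0 < b <= N)%N -> exists2 l, l \in L & hi l = b.

(** With [l] read as an edge from [lo l] to [hi l] of length [- w l], [Z b] is the length of a
    longest path from 0 to [b]; it is an integer because the lengths are. Every edge goes upwards,
    so vertices can be settled in increasing order. *)
Lemma exists_tight_potential (w : T -> int) : exists Z : nat -> int,
  {in L, forall l, (hi l <= N)%N -> 0 <= w l + Z (hi l) - Z (lo l)} /\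
  forall b, (0 < b <= N)%N ->
    exists2 l, l \in L & hi l = b /\ w l + Z (hi l) - Z (lo l) = 0.
Proof.
have [M] := ubnP N; elim: M (N) hi_onto => // M IHM [|K] ontoK leKM.
  by exists (fun=> 0); split=> [l /lo_hi|]; lia.
have [||Z [Zge0 Ztight]] := IHM K; [|lia|].
  by move=> b b_le; apply: ontoK; lia.
have [l0 l0L hi_l0] := ontoK K.+1 ltac:(lia).
pose s := [seq l <- L | hi l == K.+1].
have /(exists_seq_argmax (fun l => Z (lo l) - w l))[m] : s != [::].
  by rewrite -has_filter; apply/hasP; exists l0; rewrite ?hi_l0.
rewrite mem_filter => /andP[/eqP hi_m mL] m_max.
(* The new vertex gets its value from a best incoming edge [m], which is thereby tight; the values
   at lower vertices stay. *)
pose Z' b := if b == K.+1 then Z (lo m) - w m else Z b.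
have Z'E b : (b <= K)%N -> Z' b = Z b by rewrite /Z'; case: eqP => //; lia.
exists Z'; split=> [l lL hi_l|b b_le].
  have := lo_hi lL; have [hiK|hiK] := eqVneq (hi l) K.+1 => lo_l.
    have := m_max l; rewrite mem_filter hiK eqxx lL => /(_ isT).
    by rewrite [Z' (lo l)]Z'E ?/Z' ?hiK ?eqxx; lia.
  by have := Zge0 _ lL; rewrite !Z'E; lia.
have [->|bK] := eqVneq b K.+1.
  exists m => //; split=> //; have := lo_hi mL; rewrite hi_m => ?.
  by rewrite [Z' (lo m)]Z'E ?/Z' ?hi_m ?eqxx; lia.
have [|l lL [hi_l tight]] := Ztight b; first by lia.
by exists l => //; split=> //; have ? := lo_hi lL; rewrite !Z'E //; lia.
Qed.

(** Walk back from [N] along tight edges: the lower end strictly decreases until it reaches 0. [s]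
    is the indicator of the edges used, and their intervals from [lo] (excluded) to [hi] (included)
    partition {1, ..., N}. *)
Lemma exists_tight_path (R : numDomainType) (y : T -> int) :
  uniq L ->
  (forall b, (0 < b <= N)%N -> exists2 l, l \in L & hi l = b /\ y l = 0) ->
  exists s : T -> R,
    [/\ forall l, 0 <= s l, forall l, (y l)%:~R * s l = 0 &
        forall h, \sum_(l <- L | (lo l < h <= hi l)%N) s l
                    = (0 < h <= N)%N%:R].
Proof.
move=> uniqL; have [M] := ubnP N.
elim: M (N) => // M IHM [|K] leKM tightK.
  exists (fun=> 0); split=> // [l|h]; first by rewrite mulr0.
  by rewrite big1_eq; case: h.
have [l lL [hi_l yl]] := tightK K.+1 ltac:(lia).
have lo_l := lo_hi lL.
have [||s [s_ge0 ys s_cover]] := IHM (lo l); first by lia.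
  by move=> b b_le; apply: tightK; lia.
exists (fun k => s k + (k == l)%:R); split=> [k|k|h].
- by rewrite addr_ge0.
- by rewrite mulrDr ys add0r; case: eqP => [->|_]; rewrite ?yl ?mul0r ?mulr0.
rewrite big_split /= s_cover big_mkcond (bigD1_seq l) //= eqxx hi_l.
rewrite big1 ?addr0 => [|k /negPf ->]; last by rewrite if_same.
have -> : (0 < h <= lo l)%N = (0 < h <= K.+1)%N && (h <= lo l)%N by lia.
have -> : (lo l < h <= K.+1)%N = (0 < h <= K.+1)%N && ~~ (h <= lo l)%N by lia.
by case: (0 < h <= K.+1)%N; case: (h <= lo l)%N; rewrite /= ?addr0 ?add0r.
Qed.

End LongestPath.

(** * Indexing the inequalities *)

(* [Box j k] covers both the last family of inequalities and, for
   [k = j + 2], the triangle inequalities, as the form [X n j j] is zero. *)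
Inductive row := Top | Last of nat | First of nat | Box of nat & nat.

Definition row_code (l : row) : nat * nat * nat :=
  match l with
  | Top => (0, 0, 0) | Last i => (1, i, 0)
  | First i => (2, i, 0) | Box j k => (3, j, k)
  end%N.

Definition row_decode (c : nat * nat * nat) : row :=
  match c with
  | (0, _, _) => Top | (1, i, _) => Last i
  | (2, i, _) => First i | (_, j, k) => Box j k
  end%N.

Lemma row_codeK : cancel row_code row_decode. Proof. by case. Qed.

HB.instance Definition _ := Equality.copy row (can_type row_codeK).

Definition rows (n : nat) : seq row :=
  [:: Top]
  ++ [seq Last i | i <- iota 1 n.-1]
  ++ [seq First i | i <- iota 1 n.-1]
  ++ [seq Box i.-1 i.+1 | i <- iota 1 n.-1]
  ++ [seq Box j k
       | j <- iota 0 n.+1, k <- [seq k <- iota 0 n.+1 | (j < k - 2)%N]].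

Definition is_row (n : nat) (l : row) : bool :=
  match l with
  | Top => true
  | Last i | First i => (0 < i < n)%N
  | Box j k => (j.+1 < k <= n)%N
  end.

Lemma mem_rows n l : (l \in rows n) = is_row n l.
Proof.
have inj_Last : injective Last by move=> ? ? [].
have inj_First : injective First by move=> ? ? [].
rewrite /rows 4!mem_cat mem_seq1.
have notin (T : eqType) (f : T -> row) (s : seq T) :
  (forall x, l <> f x) -> (l \in [seq f x | x <- s]) = false.
  by move=> lf; apply/mapP => -[x _ /lf].
have notin_pairs s (t : nat -> seq nat) : (forall j k, l <> Box j k) ->
    (l \in [seq Box j k | j <- s, k <- t j]) = false.
  by move=> lf; apply/negP => /allpairsPdep[j [k [_ _ /lf]]].
case: l notin notin_pairs => [|i|i|j k] notin notin_pairs //.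
- rewrite (_ : (_ == Top) = false) // (mem_map inj_Last) !notin //.
  rewrite notin_pairs // !orbF mem_iota /=.
  by apply/idP/idP; lia.
- rewrite (_ : (_ == Top) = false) // (mem_map inj_First) !notin //.
  rewrite notin_pairs // !orbF mem_iota /=.
  by apply/idP/idP; lia.
rewrite (_ : (_ == Top) = false) // ![_ \in map Last _]notin //.
rewrite [_ \in map First _]notin // !orFb.
rewrite /is_row.
apply/orP/idP => [[/mapP[i + [-> ->]]|/allpairsPdep[j' [k' [+ + [-> ->]]]]]|].
- by rewrite mem_iota; lia.
- by rewrite mem_filter !mem_iota; lia.
move=> jk; have [k2|k2] := eqVneq k j.+2.
  by left; apply/mapP; exists j.+1; rewrite ?k2 // mem_iota; lia.
right; apply/allpairsPdep; exists j, k; rewrite mem_filter !mem_iota.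
by split=> //; lia.
Qed.

Lemma uniq_rows n : uniq (rows n).
Proof.
have inj_Last : injective Last by move=> ? ? [].
have inj_First : injective First by move=> ? ? [].
have disj (s t : seq row) (P : pred row) :
    all P s -> all (predC P) t -> ~~ has [in s] t.
  move=> /allP Ps /allP Pt; apply/hasPn => l /Pt /= nPl.
  by apply: contra nPl => /Ps.
have all_map_iota (P : pred row) (f : nat -> row) :
    (forall i, (0 < i)%N -> P (f i)) -> all P [seq f i | i <- iota 1 n.-1].
  by move=> Pf; apply/allP => _ /mapP[i + ->]; rewrite mem_iota => /andP[/Pf].
have all_pairs (P : pred row) : (forall j k, (j < k - 2)%N -> P (Box j k)) ->
    all P [seq Box j k
            | j <- iota 0 n.+1, k <- [seq k <- iota 0 n.+1 | (j < k - 2)%N]].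
  move=> PB; apply/allP => _ /allpairsPdep[j [k [_ + ->]]].
  by rewrite mem_filter => /andP[/PB].
rewrite /rows 4!cat_uniq (map_inj_uniq inj_Last).
rewrite (map_inj_uniq inj_First) iota_uniq !andTb.
have -> := disj _ _ (pred1 Top); last 2 first.
- by [].
- by rewrite 3!all_cat !all_map_iota ?all_pairs.
have -> := disj _ _ (fun l => if l is Last _ then true else false);
  last 2 first.
- exact: all_map_iota.
- by rewrite 2!all_cat !all_map_iota ?all_pairs.
have -> := disj _ _ (fun l => if l is First _ then true else false);
  last 2 first.
- exact: all_map_iota.
- by rewrite all_cat all_map_iota ?all_pairs.
(* Triangle and four-point rows share a constructor; the gap between the indices separates them. *)
have -> := disj _ _ (fun l => if l is Box j k then k == j.+2 else false);
  last 2 first.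
- by apply: all_map_iota => -[].
- by apply: all_pairs => j k /= jk; apply/eqP; lia.
rewrite !andTb map_inj_in_uniq ?iota_uniq; last first.
  by move=> i i'; rewrite !mem_iota => ? ? [? ?]; lia.
rewrite allpairs_uniq_dep ?iota_uniq // => [j _|].
  by rewrite filter_uniq ?iota_uniq.
by move=> [j k] [j' k'] _ _ /= [-> ->].
Qed.

Lemma sum_rows (V : zmodType) n (F : row -> V) :
  \sum_(l <- rows n) F l =
    F Top + \sum_(1 <= i < n) F (Last i) + \sum_(1 <= i < n) F (First i)
    + \sum_(0 <= j < n.+1) \sum_(0 <= k < n.+1 | (j.+1 < k)%N) F (Box j k).
Proof.
have iotaE : iota 1 n.-1 = index_iota 1 n by rewrite /index_iota subn1.
have pairsE : \sum_(l <- [seq Box j k | j <- iota 0 n.+1,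
                          k <- [seq k <- iota 0 n.+1 | (j < k - 2)%N]]) F l
    = \sum_(0 <= j < n.+1) \sum_(0 <= k < n.+1 | (j < k - 2)%N) F (Box j k).
  rewrite big_allpairs_dep /index_iota subn0.
  by apply: eq_bigr => j _; rewrite big_filter.
rewrite /rows 4!big_cat pairsE 3!big_map big_seq1 iotaE -!addrA.
do 3![congr (_ + _)].
have -> : \sum_(1 <= i < n) F (Box i.-1 i.+1)
    = \sum_(0 <= j < n.+1) \sum_(0 <= k < n.+1 | k == j.+2) F (Box j k).
  under [RHS]eq_bigr => j _ do rewrite big_nat1_eq.
  rewrite -big_mkcond big_add1 (big_nat_widen _ _ n.+1) /=; last by lia.
  by apply: eq_bigl => j; lia.
rewrite /= -big_split; apply: eq_bigr => j _ /=.
rewrite [RHS](bigID (fun k => k == j.+2)).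
by congr (_ + _); apply: eq_bigl => k; lia.
Qed.

(** * Telescoping and the integral inverse *)

(** The array [x] is left abstract since it is taken to be, in turn, the linear forms [X n], a real
    point, a column of the constraint matrix, and the 0/1 coefficients [active]. *)
Definition row_form (V : zmodType) (n : nat) (x : nat -> nat -> V) (l : row) :
    V :=
  match l with
  | Top => x 0%N n
  | Last i => x i n - x i.-1 n
  | First i => x 0%N i - x 0%N i.+1
  | Box j k => x j k + x j.+1 k.-1 - (x j.+1 k + x j k.-1)
  end.

(* The 0/1 coefficient of row [l] in the formula recovering [x a b] from the
   left-hand sides. *)
Definition active (a b : nat) (l : row) : bool :=
  match l with
  | Top => true
  | Last i => (i <= a)%N
  | First i => (b <= i)%N
  | Box j k => (j < a)%N && (b < k)%N
  end.

(** The [Last] rows telescope to x_an - x_0n, the [First] rows to x_0b - x_0n, and the [Box] rows,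
    in both indices, to x_0n - x_an - x_0b + x_ab. Diagonal entries of [x] are not assumed to
    vanish. *)
Lemma sum_active_row_form (V : comNzRingType) n (x : nat -> nat -> V) a b :
  (a <= b <= n)%N -> (a < n)%N -> (0 < b)%N ->
  \sum_(l <- rows n | active a b l) row_form n x l = x a b.
Proof.
move=> /andP[ab bn] an b0; rewrite big_mkcond sum_rows /=.
rewrite -!big_mkcond /=.
have -> : \sum_(1 <= i < n | (i <= a)%N) (x i n - x i.-1 n)
    = x a n - x 0%N n.
  rewrite -(@big_nat_widen _ _ _ 1 a.+1 n predT) // big_add1.
  exact: (telescope_sumr (fun i => x i n)).
have -> : \sum_(1 <= i < n | (b <= i)%N) (x 0%N i - x 0%N i.+1)
    = x 0%N b - x 0%N n.
  rewrite -(@big_nat_widenl _ _ _ b 1 n predT) //.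
  rewrite -[RHS]opprB -(telescope_sumr (x 0%N)) // -sumrN.
  by apply: eq_bigr => i _; rewrite opprB.
have -> : \sum_(0 <= j < n.+1) \sum_(0 <= k < n.+1 | (j.+1 < k)%N)
      (if (j < a)%N && (b < k)%N
       then x j k + x j.+1 k.-1 - (x j.+1 k + x j k.-1) else 0)
    = \sum_(0 <= j < a) ((x j n - x j.+1 n) - (x j b - x j.+1 b)).
  rewrite (@big_nat_widen _ _ _ 0 a n.+1 predT); last by lia.
  rewrite [RHS]big_mkcond; apply: eq_bigr => j _ /=.
  have [ja|_] := ltnP j a; last by rewrite big1.
  rewrite -(telescope_sumr (fun k => x j k - x j.+1 k)) //.
  transitivity (\sum_(b.+1 <= k < n.+1)
      ((x j k - x j.+1 k) - (x j k.-1 - x j.+1 k.-1))); last first.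
    by rewrite big_add1.
  rewrite -big_mkcondr (@big_nat_widenl _ _ _ b.+1 0 n.+1 predT) //.
  (* Since j < a <= b < k, the condition j + 1 < k holds automatically. *)
  by apply: eq_big => [k|k _] /=; [lia | ring].
rewrite -[\sum_(_ <= _ < a) _]opprK -sumrN.
rewrite (telescope_sumr_eq (fun j => x j n - x j b)) //; last first.
  by move=> k _; ring.
by ring.
Qed.

(** Turns a combination of entries of [x] into row multipliers. It serves both for the objective and
    for the relations on the diagonal. *)
Lemma sum_row_form_combination (V : comNzRingType) n (x : nat -> nat -> V)
    (I : eqType) (q : seq I) (w : I -> V) (a b : I -> nat) :
  {in q, forall i, [&& a i <= b i <= n, a i < n & 0 < b i]%N} ->
  \sum_(l <- rows n)
      (\sum_(i <- q) w i * (active (a i) (b i) l)%:R) * row_form n x l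
    = \sum_(i <- q) w i * x (a i) (b i).
Proof.
move=> abq; under eq_bigr => l _ do rewrite mulr_suml.
rewrite exchange_big /= [LHS]big_seq [RHS]big_seq; apply: eq_bigr => i iq.
have /and3P[abn an b0] := abq i iq.
rewrite -(sum_active_row_form x abn an b0) mulr_sumr [RHS]big_mkcond.
by apply: eq_bigr => l _; case: active; rewrite ?mulr1 ?mulr0 ?mul0r.
Qed.

(** The left inverse is also a right inverse: with the entries x_hh, 0 < h < n, counted as free
    coordinates, there are as many coordinates as rows. Each case reduces to an identity between 0/1
    naturals. *)
Lemma row_form_active (V : comNzRingType) n (l l' : row) :
  is_row n l -> is_row n l' ->
  row_form n (fun a b => (active a b l')%:R : V) l = (l' == l)%:R.
Proof.
have -> : (l' == l) = match l', l with
    | Top, Top => true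
    | Last i', Last i | First i', First i => i' == i
    | Box j' k', Box j k => (j' == j) && (k' == k)
    | _, _ => false end.
  apply/eqP/idP => [->|]; first by case: l => //= *; rewrite !eqxx.
  case: l' l => [|i'|i'|j' k'] [|i|i|j k] //; try by move=> /eqP ->.
  by case/andP => /eqP -> /eqP ->.
have natE (b1 b2 : bool) : b1 = b2 -> b1%:R = b2%:R :> V by move=> ->.
have sub1E (b1 b2 b3 : bool) : (b1 = b2 + b3 :> nat)%N ->
    b1%:R - b2%:R = b3%:R :> V.
  by move=> ->; rewrite natrD addrC addKr.
have sub2E (b1 b2 b3 b4 b5 : bool) : (b1 + b2 = b3 + b4 + b5)%N ->
    b1%:R + b2%:R - (b3%:R + b4%:R) = b5%:R :> V.
  by move=> eqb; rewrite -!natrD eqb natrD addrC addKr.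
case: l l' => [|i|i|j k] [|i'|i'|j' k'] //;
  rewrite /is_row /row_form /active => hl hl';
  by [apply: natE; lia | apply: sub1E; lia | apply: sub2E; lia].
Qed.

(** Allows the left-hand sides of all rows to be prescribed freely, at the price of possibly nonzero
    diagonal entries. *)
Lemma row_form_sum_active (V : comNzRingType) n (r : row -> V) l :
  l \in rows n ->
  row_form n (fun a b => \sum_(l' <- rows n | active a b l') r l') l = r l.
Proof.
move=> lL; have lin : row_form n
    (fun a b => \sum_(l' <- rows n | active a b l') r l') l
    = \sum_(l' <- rows n)
        r l' * row_form n (fun a b => (active a b l')%:R) l.
  have sumE a b : \sum_(l' <- rows n | active a b l') r l'
      = \sum_(l' <- rows n) r l' * (active a b l')%:R.
    by rewrite big_mkcond; apply: eq_bigr => l' _; case: active;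
      rewrite ?mulr1 ?mulr0.
  case: {lL} l => [|i|i|j k] /=; rewrite !sumE -?big_split -?sumrB //=;
    by apply: eq_bigr => l' _; ring.
rewrite lin (bigD1_seq l) ?uniq_rows //= big_seq_cond big1 => [|l'].
  by rewrite row_form_active -?mem_rows // eqxx mulr1 addr0.
case/andP=> l'L /negPf l'l.
by rewrite row_form_active -?mem_rows // l'l mulr0.
Qed.

(** * Optimality by complementary slackness *)

(** The duality gap of a dual feasible y at [x] is the sum of the products of its entries with the
    slacks: zero for [Y], nonnegative for any competitor. *)
Lemma TDI_certificate (R : realType) m (T : eqType) (t0 : T) (L : seq T)
    (f : T -> ineq m) :
  (forall c : 'cV[int]_m, exists (Y : T -> int) (x : 'cV[R]_m),
     let slack l := ratr (f l).2 - (map_mx ratr (f l).1 *m x) 0 0 in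
     [/\ \sum_(l <- L) (Y l)%:~R *: (f l).1 = map_mx intr c^T,
         {in L, forall l, 0 <= Y l}, {in L, forall l, 0 <= slack l} &
         {in L, forall l, (Y l)%:~R * slack l = 0}]) ->
  TDI R (lhs_mx (map f L)) (rhs_col (map f L)).
Proof.
move=> cert A b c d _ _; have [Y [x [Yc Y0 x0 Yx]]] := cert c.
have memL (i : 'I_(size (map f L))) : nth t0 L i \in L.
  by rewrite mem_nth // -(size_map f).
have tnthE i : tnth (in_tuple (map f L)) i = f (nth t0 L i).
  by rewrite (tnth_nth (f t0)) (nth_map t0) // -(size_map f).
have slackE i :
    (b - A *m x) i 0 = ratr (f (nth t0 L i)).2
                       - (map_mx ratr (f (nth t0 L i)).1 *m x) 0 0.
  rewrite !mxE tnthE; congr (_ - _); apply: eq_bigr => e _.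
  by rewrite !mxE tnthE.
have gapE y : dual_feasible A d y ->
    (b^T *m y) 0 0 = (d^T *m x) 0 0 + \sum_i y i 0 * (b - A *m x) i 0.
  case=> <- _; rewrite trmx_mul trmxK.
  have -> : \sum_i y i 0 * (b - A *m x) i 0 = (y^T *m (b - A *m x)) 0 0.
    by rewrite [RHS]mxE; apply: eq_bigr => i _; rewrite [in RHS]mxE.
  have -> : (b^T *m y) 0 0 = (y^T *m b) 0 0.
    by rewrite -[y^T *m b]trmxK trmx_mul trmxK [in RHS]mxE.
  rewrite mulmxBr mulmxA; set u := y^T *m b; set v := y^T *m A *m x.
  by rewrite [(u - v) 0 0]mxE [(- v) 0 0]mxE addrCA subrr addr0.
pose y : 'cV[int]_(size (map f L)) := \col_i Y (nth t0 L i).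
have feas : dual_feasible A d (map_mx intr y).
  split=> [|i]; last by rewrite !mxE ler0z Y0.
  apply/colP => e; have /rowP/(_ e) := Yc.
  rewrite summxE !mxE (big_nth t0) big_mkord => /(congr1 (ratr : rat -> R)).
  rewrite ratr_int => <-; rewrite rmorph_sum.
  rewrite -(size_map f); apply: eq_bigr => i _.
  by rewrite !mxE tnthE rmorphM /= ratr_int mulrC.
exists y; split=> // y' y'feas; rewrite !gapE // lerD2l.
rewrite big1 => [|i _]; last first.
  by rewrite slackE [map_mx intr y i 0]mxE [y i 0]mxE Yx.
by apply: sumr_ge0 => i _; rewrite mulr_ge0 ?slackE ?x0 //; case: y'feas.
Qed.

(** * The path system as rows, and rows as intervals *)

Lemma X_diag n i : X n i i = 0.
Proof.
apply/rowP => e; rewrite !mxE; case: eqP => // eE.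
by have := enum_valP e; rewrite inE eE setUid cards1.
Qed.

Lemma path_systemE n :
  path_system n = [seq (row_form n (X n) l, (l == Top)%:R) | l <- rows n].
Proof.
rewrite /path_system /rows 4!map_cat; congr (_ ++ (_ ++ (_ ++ (_ ++ _)))).
- by rewrite -map_comp.
- by rewrite -map_comp.
- rewrite -map_comp; apply/eq_in_map => -[|i]; rewrite ?mem_iota //= => _.
  by rewrite /form_le X_diag addr0 [X n i.+1 i.+2 + _]addrC.
by rewrite map_allpairs.
Qed.

Lemma row_form_morph (U V : zmodType) (g : U -> V) n x l :
  {morph g : u v / u + v} -> {morph g : u v / u - v} ->
  g (row_form n x l) = row_form n (fun a b => g (x a b)) l.
Proof. by move=> gD gB; case: l => *; rewrite /= ?gB ?gD. Qed.

Lemma eq_row_form (V : zmodType) n (x x' : nat -> nat -> V) l :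
  is_row n l -> (0 < n)%N ->
  (forall a b, (a <= b <= n)%N -> (a < n)%N -> (0 < b)%N -> x a b = x' a b) ->
  row_form n x l = row_form n x' l.
Proof.
move=> lL n0 eqx; case: l lL => [|i|i|j k] /= lL; rewrite !eqx //; lia.
Qed.

(** Ends of the interval, open below and closed above, of the points h in {1, ..., n-1} where the
    row occurs in the formula for x_hh. *)
Definition row_lo (l : row) : nat :=
  match l with
  | Top | First _ => 0%N | Last i => i.-1 | Box j _ => j
  end.

Definition row_hi (n : nat) (l : row) : nat :=
  match l with
  | Top | Last _ => n.-1 | First i => i | Box _ k => k.-1
  end.

Lemma active_interval n l h : (0 < h < n)%N -> is_row n l ->
  active h h l = (row_lo l < h <= row_hi n l)%N.
Proof. by move=> hn; case: l => [|i|i|j k] /= lL; lia. Qed.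

Lemma row_lo_hi n l : (1 < n)%N -> is_row n l -> (row_lo l < row_hi n l < n)%N.
Proof. by move=> n1; case: l => [|i|i|j k] /= lL; lia. Qed.

(** * Coordinates as increasing pairs of vertices *)

Lemma enum_pairs n (e : 'I_#|pairs n|) :
  exists p : 'I_n.+1 * 'I_n.+1,
    (p.1 < p.2)%N && (enum_val e == [set inord p.1; inord p.2]).
Proof.
have := enum_valP e; rewrite inE => /cards2P[a [b [ab eE]]].
have [lt_ab|lt_ba|/val_inj eq_ab] := ltngtP a b.
- by exists (a, b); rewrite /= lt_ab !inord_val eE eqxx.
- by exists (b, a); rewrite /= lt_ba !inord_val eE setUC eqxx.
- by rewrite eq_ab eqxx in ab.
Qed.

Lemma inord_pair_inj n a b a' b' :
  (a < b <= n)%N -> (a' < b' <= n)%N ->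
  [set inord a; inord b] = [set inord a'; inord b'] :> {set 'I_n.+1} ->
  a = a' /\ b = b'.
Proof.
move=> ab ab' eqab.
have inj i j : (i <= n)%N -> (j <= n)%N ->
    (inord i == inord j :> 'I_n.+1) = (i == j).
  by move=> ? ?; rewrite -val_eqE /= !inordK.
have /setP memE := eqab.
move: (memE (inord a)) (memE (inord b)) (memE (inord a')) (memE (inord b')).
by rewrite !inE !inj; lia.
Qed.

(** * The integral dual solution and its primal certificate *)

Theorem theorem1 (R : realType) (n : nat) (hn : (2 <= n)%N) :
  TDI R (lhs_mx (path_system n)) (rhs_col (path_system n)).
Proof.
rewrite path_systemE; apply: (TDI_certificate Top) => c.
have /fin_all_exists[p pP] := @enum_pairs n.
have p_lt e : ((p e).1 < (p e).2 <= n)%N.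
  by have /andP[-> _] := pP e; rewrite -ltnS ltn_ord.
have pE e : enum_val e = [set inord (p e).1; inord (p e).2].
  by have /andP[_ /eqP] := pP e.
(* An integral solution of A^T w = c, possibly with negative entries. *)
pose w l : int := \sum_e c e 0 * (active (p e).1 (p e).2 l)%:R.
have lo_hi : {in rows n, forall l, row_lo l < row_hi n l}%N.
  by move=> l; rewrite mem_rows => /(row_lo_hi hn)/andP[].
have hi_onto b : (0 < b <= n.-1)%N -> exists2 l, l \in rows n & row_hi n l = b.
  by move=> bn; exists (First b); rewrite // mem_rows /=; lia.
have [Z [Z_ge0 Z_tight]] := exists_tight_potential lo_hi hi_onto w.
(* The potential differences add a combination of the diagonal relations, which keeps A^T y = c and
   makes [y] nonnegative. *)
pose y l := w l + Z (row_hi n l) - Z (row_lo l).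
have [s [s_ge0 ys s_cover]] :=
  exists_tight_path lo_hi R (y := y) (uniq_rows n) Z_tight.
(* Left-hand sides of the sought point: right-hand side minus the prescribed slack [s]. *)
pose r l : R := (l == Top)%:R - s l.
pose xf a b := \sum_(l <- rows n | active a b l) r l.
pose x : 'cV[R]_#|pairs n| := \col_e xf (p e).1 (p e).2.
(* [xf] comes from a point only if its diagonal vanishes: [Top] contributes 1 at every h, and the
   tight path covers h exactly once. *)
have xf_diag h : (0 < h < n)%N -> xf h h = 0.
  move=> hn'; rewrite /xf sumrB.
  have -> : \sum_(l <- rows n | active h h l) s l = 1.
    rewrite big_seq_cond.
    rewrite (eq_bigl (fun l =>
      (l \in rows n) && (row_lo l < h <= row_hi n l)%N)).
      rewrite -big_seq_cond s_cover (_ : (0 < h <= n.-1)%N = true) //; lia.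
    move=> l /=; case lL: (l \in rows n) => //=.
    by rewrite (active_interval hn') // -mem_rows.
  rewrite big_mkcond (bigD1_seq Top) ?uniq_rows ?mem_rows //=.
  rewrite big1 ?addr0 ?subrr //.
  by move=> l /negPf ->; rewrite if_same.
have coordx a b : (a <= b <= n)%N -> (a < n)%N -> (0 < b)%N ->
    Defs.coord x a b = xf a b.
  move=> abn an b0; have [ab|ab] := eqVneq a b.
    rewrite -ab xf_diag; last by lia.
    by rewrite /Defs.coord X_diag map_mx0 mul0mx mxE.
  have e_pair : [set inord a; inord b] \in pairs n.
    by rewrite inE cards2 -val_eqE /= !inordK ?ab //; lia.
  pose e := enum_rank_in e_pair [set inord a; inord b].
  have eE : enum_val e = [set inord a; inord b] by rewrite enum_rankK_in.
  rewrite (coordE _ eE) mxE.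
  have ab' : (a < b <= n)%N by lia.
  have eq_pair : [set inord (p e).1; inord (p e).2]
      = [set inord a; inord b] :> {set 'I_n.+1} by rewrite -pE.
  by have [-> ->] := inord_pair_inj (p_lt e) ab' eq_pair.
have slackE l : l \in rows n ->
    ratr (l == Top)%:R - (map_mx ratr (row_form n (X n) l) *m x) 0 0 = s l.
  move=> lL; rewrite ratr_nat.
  rewrite (row_form_morph (g := fun u => (map_mx ratr u *m x) 0 0));
    last 2 first.
  - by move=> u v /=; rewrite map_mxD mulmxDl mxE.
  - by move=> u v /=; rewrite map_mxB mulmxBl !mxE.
  rewrite (eq_row_form (x' := xf)) -?mem_rows //; last by lia.
  by rewrite row_form_sum_active // /r opprB addrC subrK.
exists y, x; split=> [|l lL|l lL|l lL]; last 3 first.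
- by apply: Z_ge0 => //; have := lL; rewrite mem_rows => /(row_lo_hi hn); lia.
- by rewrite slackE.
- by rewrite slackE.
(* The potential difference is split into its unit steps, each a multiplier of the relation at h. *)
have yE l : l \in rows n -> y l = \sum_e c e 0 * (active (p e).1 (p e).2 l)%:R
    + \sum_(1 <= h < n) (Z h - Z h.-1) * (active h h l)%:R.
  rewrite mem_rows => lL; rewrite /y -addrA; congr (_ + _).
  have /andP[lo_l hi_l] := row_lo_hi hn lL.
  rewrite -telescope_sumr; last exact: ltnW.
  rewrite big_add1 (@big_nat_widenl _ _ _ (row_lo l) 0 _ predT) //.
  rewrite (@big_nat_widen _ _ _ 0 (row_hi n l) n.-1) /=; last by lia.
  rewrite big_mkcond; apply: eq_big_nat => h hn'.
  rewrite (@active_interval n) //; last by lia.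
  by rewrite ltnS; case: ifP; rewrite ?mulr1 ?mulr0.
apply/rowP => e; rewrite summxE !mxE.
(* Evaluated on [F], the rows give column [e] of the constraint matrix. *)
pose F a b : rat := X n a b 0 e.
transitivity (\sum_(l <- rows n)
    (\sum_e' (c e' 0)%:~R * (active (p e').1 (p e').2 l)%:R
     + \sum_(1 <= h < n) (Z h - Z h.-1)%:~R * (active h h l)%:R)
    * row_form n F l).
  rewrite [LHS]big_seq [RHS]big_seq; apply: eq_bigr => l lL.
  rewrite mxE yE // rmorphD !rmorph_sum.
  rewrite (row_form_morph (g := fun u : 'rV_#|pairs n| => u 0 e)); last 2 first.
  - by move=> u v; rewrite mxE.
  - by move=> u v; rewrite !mxE.
  by congr ((_ + _) * _); apply: eq_bigr => i _; rewrite rmorphM /= rmorph_nat.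
under eq_bigr => l _ do rewrite mulrDl.
rewrite big_split /= !sum_row_form_combination; last 2 first.
- by move=> h; rewrite mem_index_iota => hn'; lia.
- by move=> e' _; have := p_lt e'; lia.
(* The diagonal relations contribute nothing, because the form x_hh is zero. *)
rewrite [X in _ + X]big1 ?addr0 => [|h _]; last first.
  by rewrite /F X_diag mxE mulr0.
rewrite (bigD1 e) //= big1 ?addr0 => [|e' e'e]; rewrite /F mxE -pE.
  by rewrite eqxx mulr1.
by rewrite (inj_eq enum_val_inj) eq_sym (negPf e'e) mulr0.
Qed.
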